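(* Let $K$ be a field, let $0\le \ell\le n$ be integers with $n \geq 1$, and let $T\in K^{n\times n}$ be a nilpotent matrix. Then there is an invertible $K$-linear map $\varphi : K^{\binom{n}{\ell}}\to K^{\binom{n}{n-\ell}}$ (depending on $T$) between the spaces of Plücker coordinate vectors such that the induced isomorphism of projective spaces $\mathbb{P}^{\binom{n}{\ell}-1}\to \mathbb{P}^{\binom{n}{n-\ell}-1}$ maps $\mathrm{Gr}(\ell,n)^T$ onto $\mathrm{Gr}(n-\ell,n)^T$, and such that under this coordinate change the shuffle equations coincide: pulling back along $\varphi$ the $K$-linear span of the shuffle equations of $T$ for $\mathrm{Gr}(n-\ell,n)$ gives exactly the $K$-linear span of the shuffle equations of $T$ for $\mathrm{Gr}(\ell,n)$.
   Context: Vectors in $K^n$ are row vectors and matrices act on the right: for a subspace $L\subseteq K^n$, $LT=\{vT: v\in L\}$. The Grassmannian $\mathrm{Gr}(\ell,n)$ parametrizes $\ell$-dimensional subspaces $L$ of $K^n$ and is embedded in $\mathbb{P}^{\binom{n}{\ell}-1}$ by the Plücker embedding: $L$, written as the row space of an $\ell\times n$ matrix, is sent to the row vector $P=(p_I)$ of maximal minors of that matrix, with $I=\{i_1<\dots<i_\ell\}\subseteq\{1,\dots,n\}$. We set $\mathrm{Gr}(\ell,n)^T=\{L\in \mathrm{Gr}(\ell,n): LT\subseteq L\}$, a closed subvariety. Shuffle equations of $T$ (for $\mathrm{Gr}(\ell,n)$): let $z$ be an indeterminate and let $\wedge_\ell(\mathrm{Id}_n+zT)$ be the $\ell$th exterior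 power (compound matrix) of $\mathrm{Id}_n+zT$, the $\binom n\ell\times\binom n\ell$ matrix whose $(I,J)$ entry is the minor of $\mathrm{Id}_n+zT$ with row set $I$ and column set $J$. Write $\wedge_\ell(\mathrm{Id}_n+zT)=\wedge_\ell\mathrm{Id}_n+\sum_{i=1}^{\ell}[\wedge_\ell(\mathrm{Id}_n+zT)]_i\,z^i$, where each $[\wedge_\ell(\mathrm{Id}_n+zT)]_i$ is a matrix over $K$. With $P=(p_I)$ the row vector of Plücker coordinate variables, the shuffle equations are the linear forms in the $p_I$ that are the coordinates of the row vectors $P\cdot[\wedge_\ell(\mathrm{Id}_n+zT)]_i$ for $i=1,\dots,\ell$. *)

(* Defs.v *)
From HB Require Import structures.
From mathcomp Require Import all_boot all_order all_algebra.

Set Implicit Arguments.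
Unset Strict Implicit.
Unset Printing Implicit Defensive.

Import GRing.Theory.
Local Open Scope ring_scope.

(* The increasing sequences i_1 < ... < i_l in 'I_n, numbered by 'I_'C(n, l),
   so that Plücker vectors live in 'rV[K]_'C(n, l). *)
Definition subset_idx (n l : nat) (I : 'I_'C(n, l)) : l.-tuple 'I_n :=
  enum_val (cast_ord (esym (card_ltn_sorted_tuples l n)) I).

Lemma subset_idx_sorted n l (I : 'I_'C(n, l)) :
  sorted ltn (map val (subset_idx I)).
Proof.
have := enum_valP (cast_ord (esym (card_ltn_sorted_tuples l n)) I).
by rewrite inE.
Qed.

Lemma subset_idx_inj n l : injective (@subset_idx n l).
Proof. by move=> I J /enum_val_inj/cast_ord_inj. Qed.

Definition compound_mx (R : comNzRingType) (n l : nat) (A : 'M[R]_n) :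
    'M[R]_'C(n, l) :=
  \matrix_(I, J) \det (mxsub (tnth (subset_idx I)) (tnth (subset_idx J)) A).

Definition plucker (K : fieldType) (n l : nat) (A : 'M[K]_(l, n)) :
    'rV[K]_'C(n, l) :=
  \row_J \det (colsub (tnth (subset_idx J)) A).

(* A point of the projective space of V is a one-dimensional subspace of V.
   Here x is the Plücker point of the row space of A. *)
Definition grassmannian_fixed (K : fieldType) (n l : nat) (T : 'M[K]_n)
    (x : {vspace 'rV[K]_'C(n, l)}) : Prop :=
  exists A : 'M[K]_(l, n),
    [/\ row_free A, (A *m T <= A)%MS & x = <[plucker A]>%VS].

Definition shuffle_mx (K : fieldType) (n l : nat) (T : 'M[K]_n) (i : nat) :
    'M[K]_'C(n, l) :=
  map_mx (coefp i) (compound_mx l (1%:M + 'X *: map_mx polyC T)).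

Definition shuffle_fun (K : fieldType) (n l : nat) (T : 'M[K]_n) (i : nat)
    (J : 'I_'C(n, l)) (P : 'rV[K]_'C(n, l)) : K^o :=
  (P *m shuffle_mx l T i) 0 J.

Fact shuffle_fun_is_linear K n l T i J : linear (@shuffle_fun K n l T i J).
Proof. by move=> a P Q; rewrite /shuffle_fun mulmxDl -scalemxAl !mxE. Qed.

HB.instance Definition _ (K : fieldType) n l T i J :=
  GRing.isLinear.Build K 'rV[K]_'C(n, l) K^o *:%R (@shuffle_fun K n l T i J)
    (@shuffle_fun_is_linear K n l T i J).

Definition shuffle_form (K : fieldType) (n l : nat) (T : 'M[K]_n) (i : nat)
    (J : 'I_'C(n, l)) : 'Hom('rV[K]_'C(n, l), K^o) :=
  linfun (shuffle_fun T i J).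

Lemma shuffle_formE (K : fieldType) n l (T : 'M[K]_n) i (J : 'I_'C(n, l)) P :
  shuffle_form T i J P = (P *m shuffle_mx l T i) 0 J.
Proof. by rewrite lfunE. Qed.

Definition shuffle_span (K : fieldType) (n l : nat) (T : 'M[K]_n) :
    {vspace 'Hom('rV[K]_'C(n, l), K^o)} :=
  <<[seq shuffle_form T i J | i <- iota 1 l, J <- enum 'I_'C(n, l)]>>%VS.

(* Main.v *)
Require Import Defs.
From mathcomp Require Import all_boot all_order all_algebra all_fingroup.

Set Implicit Arguments.
Unset Strict Implicit.
Unset Printing Implicit Defensive.

Import GRing.Theory.
Local Open Scope ring_scope.

(** The duality is passage to the annihilator, followed by a change of basis
    that turns the transpose of [T] back into [T].

    The determinant of a stacked matrix [col_mx A B], with [A] of [l] rows and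
    [B] of [m = n - l] rows, is a bilinear function of the Plücker vectors of
    [A] and [B] (Laplace expansion).  Its matrix [wedge_mx] is the pairing of
    the [l]-th and [m]-th exterior powers into the top one.  If [A] and [B] are
    of full rank and the row space of [B] is the annihilator of that of [A],
    then [wedge_mx] sends the Plücker vector of [A] to a nonzero multiple of
    that of [B] ([wedge_mx_orthogonal]); applied to coordinate subspaces this
    also shows that [wedge_mx] is invertible.  The annihilator of a [T]-stable
    space is [T^T]-stable.

    A nilpotent [T] is similar to its transpose: [S *m T = T^T *m S] for some
    invertible [S], the inverse of the matrix in [nilpotent_tr_similar].  Hence [B |-> B *m S] carries
    [T^T]-stable spaces to [T]-stable ones, and by Cauchy-Binet it acts on
    Plücker vectors through the compound matrix of [S].  The map
    [phi P = P *m F] with [F = wedge_mx *m compound_mx m S] therefore exchanges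
    the two fixed loci.

    For the shuffle equations put [M = 1 + zT], so that
    [compound_mx l M = 1 + C_1 z + C_2 z^2 + ...], and write [C'_i] for the
    coefficients of [compound_mx m M].  The pairing satisfies
    [compound_mx l M *m wedge_mx *m (compound_mx m M)^T = \det M *: wedge_mx],
    and [\det M = 1] because [T] is nilpotent; with [S M = M^T S] this becomes
    [compound_mx l M *m F *m compound_mx m M = F].  Comparing coefficients of
    [z^i] for [i > 0] gives [F C'_i = - \sum_(0 < j <= i) C_j F C'_(i-j)]: the
    columns of [F C'_i] are combinations of columns of the [C_j], that is, the
    pullback of every shuffle equation is in the span of shuffle equations.
    The identity is equivalent to the one with [l] and [m] exchanged and [F]
    replaced by its inverse ([shuffle_intertwiner_inv]), whence the opposite
    inclusion. *)

(** * Increasing index sequences *)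

Lemma subset_idx_surj n l (t : l.-tuple 'I_n) :
  sorted ltn (map val t) -> exists I, subset_idx I = t.
Proof.
move=> ts; have tP : t \in [set t : l.-tuple 'I_n | sorted ltn (map val t)].
  by rewrite inE.
exists (cast_ord (card_ltn_sorted_tuples l n) (enum_rank_in tP t)).
by rewrite /subset_idx cast_ordK enum_rankK_in.
Qed.

Lemma subset_idx_uniq n l (I : 'I_'C(n, l)) : uniq (subset_idx I).
Proof.
rewrite -(map_inj_uniq val_inj).
by apply: sorted_uniq (subset_idx_sorted I); [apply: ltn_trans|move=> x; apply: ltnn].
Qed.

Lemma tnth_subset_idx_inj n l (I : 'I_'C(n, l)) :
  injective (tnth (subset_idx I)).
Proof. by apply/tuple_uniqP/subset_idx_uniq. Qed.

Lemma subset_idx_sub n l (I J : 'I_'C(n, l)) :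
  {subset subset_idx I <= subset_idx J} -> I = J.
Proof.
move=> sIJ; apply: subset_idx_inj; apply: val_inj.
have [|_ eIJ] := uniq_min_size (subset_idx_uniq I) sIJ.
  by rewrite !size_tuple.
apply: (inj_map val_inj); apply: (irr_sorted_eq ltn_trans ltnn);
  try exact: subset_idx_sorted.
by move=> x; apply: (perm_mem (perm_map val _)); apply: uniq_perm;
  rewrite ?subset_idx_uniq.
Qed.

(** With the uniqueness of [I] and [p], this turns a sum over injective maps into
    a double sum over index sets and permutations. *)
Lemma inj_subset_idx_perm n l (s : {ffun 'I_l -> 'I_n}) : injective s ->
  exists I, exists p : 'S_l, s = [ffun i => tnth (subset_idx I) (p i)].
Proof.
move=> sI.
have sz : size (enum (codom s)) == l by rewrite -cardE card_codom // card_ord.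
have [|I eI] := @subset_idx_surj n l (Tuple sz).
  rewrite /= sorted_map /enum_mem; apply: sorted_filter.
    by move=> a b c; apply: ltn_trans.
  by rewrite -sorted_map -enumT val_enum_ord iota_ltn_sorted.
have sIP i : exists j, s i = tnth (subset_idx I) j.
  by apply/tnthP; rewrite eI /= mem_enum codom_f.
have [p pE] := fin_all_exists sIP.
have pI : injective p by move=> i j eij; apply: sI; rewrite !pE eij.
by exists I, (perm pI); apply/ffunP => i; rewrite ffunE permE.
Qed.

(** * Expansion of alternating multilinear forms *)

(** The same formula as [plucker], but over any commutative ring: the Laplace
    expansion is needed for matrices of polynomials. *)
Definition minors (R : comNzRingType) n l (A : 'M[R]_(l, n)) : 'rV[R]_'C(n, l) :=
  \row_J \det (colsub (tnth (subset_idx J)) A).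

Section AlternatingForms.

Variables (R : comNzRingType) (n l : nat) (f : 'M[R]_(l, n) -> R).

(** Multilinearity in the rows, in the form in which it is used: the value at [A]
    comes from expanding each row in the standard basis. *)
Definition multilinear_form := forall A : 'M[R]_(l, n),
  f A = \sum_(s : {ffun 'I_l -> 'I_n})
          (\prod_i A i (s i)) * f (rowsub s 1%:M).

(** Taking for [X] a permutation matrix gives antisymmetry, and taking for [X] a
    singular matrix that fixes [A] gives the vanishing on repeated rows, so that
    no case distinction on the characteristic is needed. *)
Definition alternating_form :=
  forall (X : 'M[R]_l) (A : 'M[R]_(l, n)), f (X *m A) = \det X * f A.

Hypotheses (f_lin : multilinear_form) (f_alt : alternating_form).

Lemma alternating_repeat (s : 'I_l -> 'I_n) i j :
  i != j -> s i = s j -> f (rowsub s 1%:M) = 0.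
Proof.
move=> ij sij; pose r k := if k == i then j else k.
have -> : rowsub s 1%:M = rowsub r 1%:M *m rowsub s 1%:M :> 'M[R]_(l, n).
  (* The left factor copies row j onto row i, which changes nothing here. *)
  rewrite mul_rowsub_mx mul1mx; apply/matrixP => a b; rewrite !mxE /r.
  by case: (eqVneq a i) => // ->; rewrite sij.
rewrite f_alt (determinant_alternate ij) ?mul0r // => b.
by rewrite !mxE /r eqxx [j == i]eq_sym (negPf ij).
Qed.

(** An alternating form is determined by its values on the coordinate subspaces:
    only injective [s] contribute to the multilinear expansion, each of them is
    an increasing sequence composed with a permutation, and for a fixed
    increasing sequence the signs add up to a minor of [A].  Cauchy-Binet and
    both halves of the Laplace expansion are instances. *)
Lemma alternating_expand A :
  f A = \sum_I minors A 0 I * f (rowsub (tnth (subset_idx I)) 1%:M).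
Proof.
pose F (s : {ffun 'I_l -> 'I_n}) := (\prod_i A i (s i)) * f (rowsub s 1%:M).
pose h (u : 'I_'C(n, l) * 'S_l) := [ffun i => tnth (subset_idx u.1) (u.2 i)].
have hI : injective h.
  move=> [I p] [J q] /ffunP/= e.
  have eIJ : I = J.
    apply: subset_idx_sub => x /tnthP[i ->].
    by have := e (p^-1%g i); rewrite !ffunE /= permKV => ->; apply: mem_tnth.
  rewrite -{J}eIJ in e *; congr (_, _); apply/permP => i.
  by have := e i; rewrite !ffunE; apply: tnth_subset_idx_inj.
have sumF : \sum_s F s = \sum_u F (h u).
  transitivity (\sum_(s in [set h u | u in predT]) F s); last first.
    by rewrite big_imset // => u v _ _; apply: hI.
  rewrite [RHS]big_mkcond /=; apply: eq_bigr => s _.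
  case: imsetP => // ns; case: (boolP (injectiveb s)) => [/injectiveP sI|].
    by have [I [p sE]] := inj_subset_idx_perm sI; case: ns; exists (I, p).
  move=> /injectivePn[i [j ij sij]].
  by rewrite /F (alternating_repeat ij sij) mulr0.
rewrite f_lin sumF -(pair_big xpredT xpredT (fun I p => F (h (I, p)))) /=.
apply: eq_bigr => I _; rewrite mxE /determinant mulr_suml.
apply: eq_bigr => p _; rewrite /F.
have -> : rowsub (h (I, p)) 1%:M
    = perm_mx p *m rowsub (tnth (subset_idx I)) 1%:M :> 'M[R]_(l, n).
  by rewrite -row_permE; apply/matrixP => a b; rewrite !mxE ffunE.
rewrite f_alt det_perm mulrA [X in X * _]mulrC; congr (_ * _ * _).
by apply: eq_bigr => i _; rewrite ffunE mxE.
Qed.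

End AlternatingForms.

(** A multilinear expression is usually given as a sum, over some index set, of
    monomials with one entry of [A] in each row; this lemma puts it in the form
    required by [multilinear_form]. *)
Lemma expand_rows (R : comNzRingType) n l (A : 'M[R]_(l, n)) (T : finType)
    (u : T -> {ffun 'I_l -> 'I_n}) (G : T -> R) :
  \sum_t (\prod_i A i (u t i)) * G t =
  \sum_(s : {ffun 'I_l -> 'I_n}) (\prod_i A i (s i)) *
     \sum_t (\prod_i (rowsub s 1%:M : 'M[R]_(l, n)) i (u t i)) * G t.
Proof.
under [RHS]eq_bigr do rewrite mulr_sumr.
rewrite exchange_big /=; apply: eq_bigr => t _.
rewrite (bigD1 (u t)) //=.
have -> : \prod_i (rowsub (u t) 1%:M : 'M[R]_(l, n)) i (u t i) = 1.
  by rewrite big1 // => i _; rewrite !mxE eqxx.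
rewrite mul1r.
rewrite [X in _ + X]big1 ?addr0 // => s ne.
have [i ni] : exists i, s i != u t i.
  apply/existsP; apply: contraNT ne => /existsPn e.
  by apply/eqP/ffunP => i; have := e i; rewrite negbK => /eqP.
by rewrite [X in _ * (X * _)](bigD1 i) //= !mxE (negPf ni) !mul0r mulr0.
Qed.

(** * Cauchy-Binet and compound matrices *)

Lemma multilinear_det_mulmx (R : comNzRingType) n l (B : 'M[R]_(n, l)) :
  multilinear_form (fun A : 'M[R]_(l, n) => \det (A *m B)).
Proof.
have detE (A : 'M[R]_(l, n)) : \det (A *m B) =
    \sum_(t : 'S_l * {ffun 'I_l -> 'I_n}) (\prod_i A i (t.2 i)) *
       ((-1) ^+ t.1 * \prod_i B (t.2 i) (t.1 i)).
  rewrite -(pair_big xpredT xpredT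
    (fun (p : 'S_l) (s : {ffun 'I_l -> 'I_n}) => (\prod_i A i (s i)) *
       ((-1) ^+ p * \prod_i B (s i) (p i)))) /=.
  apply: eq_bigr => p _.
  under eq_bigr do rewrite mxE.
  rewrite bigA_distr_bigA mulr_sumr; apply: eq_bigr => s _.
  by rewrite big_split /= mulrCA.
move=> A; rewrite detE expand_rows; apply: eq_bigr => s _.
by rewrite detE.
Qed.

Theorem cauchy_binet (R : comNzRingType) n l (A : 'M[R]_(l, n)) (B : 'M_(n, l)) :
  \det (A *m B) = \sum_I minors A 0 I * \det (rowsub (tnth (subset_idx I)) B).
Proof.
have alt : alternating_form (fun A : 'M[R]_(l, n) => \det (A *m B)).
  by move=> X A'; rewrite -mulmxA det_mulmx.
rewrite (alternating_expand (@multilinear_det_mulmx _ _ _ B) alt).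
by apply: eq_bigr => I _; rewrite mul_rowsub_mx mul1mx.
Qed.

Lemma minorsM (R : comNzRingType) n l (A : 'M[R]_(l, n)) (B : 'M_n) :
  minors (A *m B) = minors A *m compound_mx l B.
Proof.
apply/rowP => J; rewrite !mxE -mulmx_colsub cauchy_binet.
by apply: eq_bigr => I _; rewrite !mxE; congr (_ * \det _); apply/matrixP => i j;
  rewrite !mxE.
Qed.

Lemma row_compound_mx (R : comNzRingType) n l (A : 'M[R]_n) (I : 'I_'C(n, l)) :
  row I (compound_mx l A) = minors (rowsub (tnth (subset_idx I)) A).
Proof.
by apply/rowP => J; rewrite !mxE; congr (\det _); apply/matrixP => i j; rewrite !mxE.
Qed.

Lemma compound_mxM (R : comNzRingType) n l (A B : 'M[R]_n) :
  compound_mx l (A *m B) = compound_mx l A *m compound_mx l B.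
Proof.
apply/row_matrixP => I.
by rewrite row_mul !row_compound_mx -mul_rowsub_mx minorsM.
Qed.

Lemma compound_mx1 (R : comNzRingType) n l :
  compound_mx l 1%:M = 1%:M :> 'M[R]_'C(n, l).
Proof.
apply/matrixP => I J; rewrite !mxE; case: (eqVneq I J) => [->|nIJ].
  rewrite -[RHS](det1 R l); congr (\det _); apply/matrixP => i j; rewrite !mxE.
  by rewrite (inj_eq (@tnth_subset_idx_inj _ _ _)).
have [i ni] : exists i, tnth (subset_idx I) i \notin subset_idx J.
  apply/existsP; apply: contraNT nIJ => /existsPn e.
  apply/eqP/subset_idx_sub => x /tnthP[i ->].
  by have := e i; rewrite negbK.
rewrite (expand_det_row _ i) big1 // => j _.
rewrite !mxE; case: eqP => [e|_]; last by rewrite mul0r.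
by rewrite e mem_tnth in ni.
Qed.

Lemma compound_mx_tr (R : comNzRingType) n l (A : 'M[R]_n) :
  compound_mx l A^T = (compound_mx l A)^T.
Proof.
by apply/matrixP => I J; rewrite !mxE -det_tr; congr (\det _);
  apply/matrixP => i j; rewrite !mxE.
Qed.

Lemma map_compound_mx (R S : comNzRingType) (h : {rmorphism R -> S}) n l
    (A : 'M[R]_n) :
  map_mx h (compound_mx l A) = compound_mx l (map_mx h A).
Proof. by apply/matrixP => I J; rewrite !mxE -det_map_mx map_mxsub. Qed.

Lemma minors_unit_rows (R : comNzRingType) n l (I : 'I_'C(n, l)) :
  minors (rowsub (tnth (subset_idx I)) 1%:M) = delta_mx 0 I :> 'rV[R]_'C(n, l).
Proof. by rewrite -row_compound_mx compound_mx1 row1. Qed.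

(** * Laplace expansion and the wedge pairing *)

(** The wedge product of the exterior powers of order [l] and [m] into the top
    one, in the standard bases: up to sign, the permutation matrix of
    complementation of index sets. *)
Definition wedge_mx (R : comNzRingType) l m : 'M[R]_('C(l + m, l), 'C(l + m, m)) :=
  \matrix_(I, J) \det (col_mx (rowsub (tnth (subset_idx I)) 1%:M)
                              (rowsub (tnth (subset_idx J)) 1%:M)).

Lemma multilinear_det_col_mxl (R : comNzRingType) l m (B : 'M[R]_(m, l + m)) :
  multilinear_form (fun A : 'M[R]_(l, l + m) => \det (col_mx A B)).
Proof.
have detE (A : 'M[R]_(l, l + m)) : \det (col_mx A B) =
    \sum_(p : 'S_(l + m)) (\prod_i A i ([ffun i => p (lshift m i)] i)) *
       ((-1) ^+ p * \prod_j B j (p (rshift l j))).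
  apply: eq_bigr => p _; rewrite big_split_ord /= mulrCA.
  congr (_ * (_ * _)); apply: eq_bigr => i _; rewrite ?ffunE ?col_mxEu //.
  by rewrite col_mxEd.
by move=> A; rewrite detE expand_rows; apply: eq_bigr => s _; rewrite detE.
Qed.

Lemma multilinear_det_col_mxr (R : comNzRingType) l m (A : 'M[R]_(l, l + m)) :
  multilinear_form (fun B : 'M[R]_(m, l + m) => \det (col_mx A B)).
Proof.
have detE (B : 'M[R]_(m, l + m)) : \det (col_mx A B) =
    \sum_(p : 'S_(l + m)) (\prod_j B j ([ffun j => p (rshift l j)] j)) *
       ((-1) ^+ p * \prod_i A i (p (lshift m i))).
  apply: eq_bigr => p _; rewrite big_split_ord /= mulrA mulrC.
  congr (_ * (_ * _)); apply: eq_bigr => i _; rewrite ?ffunE ?col_mxEu //.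
  by rewrite col_mxEd.
by move=> B; rewrite detE expand_rows; apply: eq_bigr => s _; rewrite detE.
Qed.

Lemma alternating_det_col_mxl (R : comNzRingType) l m (B : 'M[R]_(m, l + m)) :
  alternating_form (fun A : 'M[R]_(l, l + m) => \det (col_mx A B)).
Proof.
move=> X A; have -> : col_mx (X *m A) B = block_mx X 0 0 1%:M *m col_mx A B.
  by rewrite mul_block_col !mul0mx mul1mx addr0 add0r.
by rewrite det_mulmx det_ublock det1 mulr1.
Qed.

Lemma alternating_det_col_mxr (R : comNzRingType) l m (A : 'M[R]_(l, l + m)) :
  alternating_form (fun B : 'M[R]_(m, l + m) => \det (col_mx A B)).
Proof.
move=> X B; have -> : col_mx A (X *m B) = block_mx 1%:M 0 0 X *m col_mx A B.
  by rewrite mul_block_col !mul0mx mul1mx addr0 add0r.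
by rewrite det_mulmx det_ublock det1 mul1r.
Qed.

Lemma minors_wedge_mxE (R : comNzRingType) l m (A : 'M[R]_(l, l + m)) J :
  (minors A *m wedge_mx R l m) 0 J =
  \det (col_mx A (rowsub (tnth (subset_idx J)) 1%:M)).
Proof.
rewrite (alternating_expand (@multilinear_det_col_mxl _ _ _ _)
           (@alternating_det_col_mxl _ _ _ _)) mxE.
by apply: eq_bigr => I _; rewrite [in RHS]mulrC mulrC !mxE.
Qed.

(** Generalised Laplace expansion along the first [l] rows, with the signs of
    complementary minors recorded by [wedge_mx]. *)
Theorem laplace_expansion (R : comNzRingType) l m
    (A : 'M[R]_(l, l + m)) (B : 'M[R]_(m, l + m)) :
  \det (col_mx A B) = (minors A *m wedge_mx R l m *m (minors B)^T) 0 0.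
Proof.
rewrite (alternating_expand (@multilinear_det_col_mxr _ _ _ _)
           (@alternating_det_col_mxr _ _ _ _)) mxE.
by apply: eq_bigr => J _; rewrite minors_wedge_mxE mulrC [in RHS]mxE.
Qed.

(** The wedge product of the images under [M] is the image of the wedge product,
    on which [M] acts by its determinant. *)
Lemma compound_wedge_mx (R : comNzRingType) l m (M : 'M[R]_(l + m)) :
  compound_mx l M *m wedge_mx R l m *m (compound_mx m M)^T = \det M *: wedge_mx R l m.
Proof.
apply/matrixP => I J.
transitivity ((row I (compound_mx l M) *m wedge_mx R l m
                 *m (row J (compound_mx m M))^T) 0 0).
  by rewrite tr_row -row_mul !mxE; apply: eq_bigr => K _; rewrite !mxE.
rewrite !row_compound_mx -laplace_expansion.
rewrite -[X in rowsub _ X]mul1mx -[X in col_mx _ (rowsub _ X)]mul1mx.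
by rewrite -!mul_rowsub_mx -mul_col_mx det_mulmx mulrC !mxE.
Qed.

(** * Annihilators in Plücker coordinates *)

Lemma orthogonal_complement (K : fieldType) n l m (A : 'M[K]_(l, n)) :
    (l + m = n)%N -> row_free A ->
  exists B : 'M[K]_(m, n),
    [/\ row_free B, A *m B^T = 0
      & forall p (X : 'M[K]_(p, n)), A *m X^T = 0 -> (X <= B)%MS].
Proof.
move=> lm fA.
have rk : \rank (kermx A^T) = m.
  by rewrite mxrank_ker mxrank_tr (eqP fA) -lm addKn.
have /= eqB := eq_row_base (kermx A^T).
move: (row_base _) (row_base_free (kermx A^T)) eqB; rewrite rk => B fB eqB.
exists B; split => // [|p X AX0].
  by apply: trmx_inj; rewrite trmx_mul trmxK trmx0; apply/sub_kermxP; rewrite -eqB.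
by rewrite eqB; apply/sub_kermxP; rewrite -[X]trmxK -trmx_mul AX0 trmx0.
Qed.

(** For any [X], multiply [col_mx A X] by [row_mx A' B^T], where [A'] is a right
    inverse of [A]: the product is block triangular with determinant
    [\det (X *m B^T)].  Hence [\det (col_mx A X)] is, up to the constant
    [\det (row_mx A' B^T)], the pairing of the Plücker vectors of [X] and [B];
    letting [X] run over the coordinate subspaces gives the claim. *)
Lemma wedge_mx_orthogonal (K : fieldType) l m
    (A : 'M[K]_(l, l + m)) (B : 'M[K]_(m, l + m)) :
    row_free A -> row_free B -> A *m B^T = 0 ->
  exists2 c, c != 0 & minors A *m wedge_mx K l m = c *: minors B.
Proof.
move=> /row_freeP[A' AA'] /row_freeP[B' BB'] AB0.
pose q := \det (row_mx A' B^T).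
have detE (X : 'M[K]_(m, l + m)) : \det (col_mx A X) * q = \det (X *m B^T).
  rewrite -det_mulmx mul_col_row AA' AB0.
  by rewrite det_lblock det1 mul1r.
have q0 : q != 0.
  (* For the transpose of a right inverse of B, the right-hand side is 1. *)
  apply/eqP => q0; have := detE B'^T; rewrite q0 mulr0 -trmx_mul BB' trmx1 det1.
  by move/eqP; rewrite eq_sym oner_eq0.
exists q^-1; first by rewrite invr_eq0.
apply/rowP => J; rewrite minors_wedge_mxE !mxE.
have := detE (rowsub (tnth (subset_idx J)) 1%:M).
rewrite mul_rowsub_mx mul1mx -[in RHS]det_tr => /(canRL (mulfK q0)) ->.
by rewrite mulrC; congr (_ * \det _); apply/matrixP => i j; rewrite !mxE.
Qed.

Lemma row_free_unit_rows (K : fieldType) n l (I : 'I_'C(n, l)) :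
  row_free (rowsub (tnth (subset_idx I)) 1%:M : 'M[K]_(l, n)).
Proof.
apply/row_freeP; exists (colsub (tnth (subset_idx I)) 1%:M).
rewrite mulmx_colsub mulmx1; apply/matrixP => i j; rewrite !mxE.
by rewrite (inj_eq (@tnth_subset_idx_inj _ _ _)).
Qed.

(** By [wedge_mx_orthogonal] the row space contains the Plücker vector of every
    coordinate subspace, since each of them is the annihilator of some [A]. *)
Lemma wedge_mx_invertible (K : fieldType) l m :
  exists2 W, wedge_mx K l m *m W = 1%:M & W *m wedge_mx K l m = 1%:M.
Proof.
have eC : 'C(l + m, l) = 'C(l + m, m).
  by rewrite -[RHS]bin_sub ?leq_addl // addnK.
suff full : row_full (wedge_mx K l m).
  have free : row_free (wedge_mx K l m) by rewrite /row_free (eqP full) eC.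
  have [V VE] := row_fullP full; have [W EW] := row_freeP free.
  have eVW : W = V by rewrite -[W]mul1mx -VE -mulmxA EW mulmx1.
  by exists W; rewrite // eVW.
rewrite -sub1mx; apply/row_subP => J; rewrite row1 -minors_unit_rows.
set B := rowsub _ _.
have fB : row_free B by apply: row_free_unit_rows.
have [A [fA BA0 _]] := orthogonal_complement (addnC m l) fB.
have AB0 : A *m B^T = 0 by rewrite -[A]trmxK -trmx_mul BA0 trmx0.
have [c c0 cE] := wedge_mx_orthogonal fA fB AB0.
by rewrite -[minors B](scalerK c0) -cE scalemx_sub ?submxMl.
Qed.

(** * A nilpotent matrix is similar to its transpose *)

Lemma mulmx_expn_intertwine (K : fieldType) n r (T : 'M[K]_n) (N : 'M[K]_r)
    (W : 'M[K]_(r, n)) i : W *m T = N *m W -> W *m T ^+ i = N ^+ i *m W.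
Proof.
move=> e; elim: i => [|i IH]; first by rewrite !expr0 mulmx1 mul1mx.
by rewrite exprSr -mulmxE mulmxA IH -mulmxA e mulmxA exprSr -mulmxE.
Qed.

(** Induction on [n], splitting off one cyclic block.  Let [T ^+ k.+1 = 0] and
    [(T ^+ k) i j != 0].  The rows of [C] are the iterates under [T] of the
    [i]-th basis vector, the columns of [D] those of the [j]-th coordinate form,
    and [H = C *m D] has entries [(T ^+ (a + b)) i j]: a Hankel matrix that
    vanishes below its antidiagonal and is constant and nonzero on it, hence is
    invertible.  So the space is the direct sum of the row space of [C], where
    [T] acts as the shift [N], and of the kernel of [D], which is [T]-stable.
    On the first summand [H] intertwines [N] and its transpose; on the second
    the induction hypothesis applies. *)
Lemma nilpotent_tr_similar (K : fieldType) n (T : 'M[K]_n) k : T ^+ k = 0 ->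
  exists2 S, S \in unitmx & T *m S = S *m T^T.
Proof.
elim/ltn_ind: n T k => n IH T k0 Tk0.
have exk : exists k, T ^+ k == 0 by exists k0; apply/eqP.
case: (ex_minnP exk) => -[|k] /eqP Tk kmin.
  have n0 : n = 0%N.
    case: n T Tk {IH k0 Tk0 exk kmin} => // n T /eqP.
    by rewrite expr0 oner_eq0.
  by exists 1%:M; rewrite ?unitmx1 // mulmx1 mul1mx; subst n; rewrite !flatmx0.
have [i [j Tij]] : exists i j, (T ^+ k) i j != 0.
  have nz : T ^+ k != 0 by apply/negP => /kmin; rewrite ltnn.
  have [i /existsP[j Tij]] : exists i, [exists j, (T ^+ k) i j != 0].
    apply/existsP; apply: contraNT nz => /existsPn z.
    apply/eqP/matrixP => i j; have /existsPn/(_ j) := z i.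
    by rewrite negbK mxE => /eqP.
  by exists i, j.
pose h a := (T ^+ a) i j.
have h0 a : (k < a)%N -> h a = 0.
  by move=> /subnKC <-; rewrite /h exprD Tk mul0r mxE.
pose C : 'M[K]_(k.+1, n) := \matrix_a row i (T ^+ a).
pose D : 'M[K]_(n, k.+1) := \matrix_(a, b) (T ^+ b) a j.
pose N : 'M[K]_k.+1 := \matrix_(a, b) (b == a.+1 :> nat)%:R.
have CT : C *m T = N *m C.
  apply/row_matrixP => a; rewrite !row_mul rowK -row_mul mulmxE -exprSr.
  rewrite [RHS]mulmx_sum_row.
  have [ak|ak] := ltnP a.+1 k.+1.
    rewrite (bigD1 (Ordinal ak)) //= [X in X *: _]mxE ?mxE eqxx scale1r rowK big1 ?addr0 //.
    by move=> b nb; rewrite !mxE -[_ == _]/(b == Ordinal ak) (negPf nb) scale0r.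
  have -> : a.+1 = k.+1 by apply/eqP; rewrite eqn_leq ak ltn_ord.
  rewrite Tk row0 big1 // => b _; rewrite !mxE ltn_eqF ?scale0r //.
  exact: leq_trans (ltn_ord b) ak.
have TD : T *m D = D *m N^T.
  apply: trmx_inj; rewrite !trmx_mul trmxK.
  apply/row_matrixP => a; rewrite !row_mul.
  have rD b : row b D^T = (col j (T ^+ b))^T by apply/rowP => c; rewrite !mxE.
  rewrite rD -trmx_mul colE mulmxA mulmxE -exprS -colE.
  rewrite [RHS]mulmx_sum_row.
  have [ak|ak] := ltnP a.+1 k.+1.
    rewrite (bigD1 (Ordinal ak)) //= [X in X *: _]mxE ?mxE eqxx scale1r rD big1 ?addr0 //.
    by move=> b nb; rewrite !mxE -[_ == _]/(b == Ordinal ak) (negPf nb) scale0r.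
  have -> : a.+1 = k.+1 by apply/eqP; rewrite eqn_leq ak ltn_ord.
  rewrite Tk col0 trmx0 big1 // => b _; rewrite !mxE ltn_eqF ?scale0r //.
  exact: leq_trans (ltn_ord b) ak.
pose H := C *m D.
have HE a b : H a b = h (a + b)%N.
  rewrite mxE /h exprD -mulmxE mxE.
  by apply: eq_bigr => c _; rewrite !mxE.
have NH : N *m H = H *m N^T by rewrite /H mulmxA -CT -mulmxA TD mulmxA.
(* Reversing the order of the rows makes H lower triangular. *)
have Hu : H \in unitmx.
  have : \det (rowsub (@rev_ord k.+1) 1%:M *m H) != 0.
    rewrite mul_rowsub_mx mul1mx det_trig.
      rewrite prodf_seq_neq0; apply/allP => a _ /=.
      by rewrite mxE HE /= subSS subnK -1?ltnS ?ltn_ord.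
    apply/is_trig_mxP => a b ab; rewrite mxE HE /= subSS h0 //.
    by rewrite -{1}(subnK (_ : a <= k)%N) ?ltn_add2l // -ltnS.
  rewrite det_mulmx mulf_eq0 negb_or => /andP[_ dH].
  by rewrite unitmxE unitfE.
have rD : \rank D = k.+1.
  apply/eqP; rewrite eqn_leq rank_leq_col /=.
  by rewrite -{1}(mxrank_unit Hu) mxrankM_maxr.
have rk : (k.+1 + \rank (kermx D) = n)%N.
  by rewrite mxrank_ker rD subnKC // -rD rank_leq_row.
have WD : row_base (kermx D) *m D = 0.
  by apply/sub_kermxP; rewrite eq_row_base.
have WT : (row_base (kermx D) *m T <= row_base (kermx D))%MS.
  by rewrite eq_row_base; apply/sub_kermxP;
     rewrite -mulmxA TD mulmxA WD mul0mx.
move: (row_base _) (row_base_free (kermx D)) WD WT rk.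
move: (\rank _) => r W /row_freeP[W' WW'] WD /submxP[M WT] rk.
have Mk : M ^+ k.+1 = 0.
  by rewrite -[LHS]mulmx1 -WW' mulmxA -(mulmx_expn_intertwine _ WT) Tk mulmx0 mul0mx.
have [|S Su MS] := IH r _ M k.+1 Mk; first by rewrite -rk addSn ltnS leq_addl.
clear IH; subst n.
(* P is the change of basis to the direct sum, in which T becomes the block
   matrix of N and M. *)
pose P := col_mx C W; pose B := block_mx H 0 0 S.
have Pu : P \in unitmx.
  have : \det (P *m row_mx D W') != 0.
    rewrite mul_col_row WW' WD det_ublock det1 mulr1 -unitfE -unitmxE //.
  by rewrite det_mulmx mulf_eq0 negb_or => /andP[dP _]; rewrite unitmxE unitfE.
have PT : P *m T = block_mx N 0 0 M *m P.
  by rewrite mul_col_mx CT WT mul_block_col !mul0mx addr0 add0r.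
have NB : block_mx N 0 0 M *m B = B *m (block_mx N 0 0 M)^T.
  rewrite tr_block_mx !trmx0 !mulmx_block !mulmx0 !mul0mx !addr0 !add0r NH MS //.
exists (invmx P *m B *m (invmx P)^T).
  rewrite !unitmx_mul unitmx_tr !unitmx_inv Pu /= andbT.
  by rewrite unitmxE det_ublock unitrM -!unitmxE Hu.
have PTi : T *m invmx P = invmx P *m block_mx N 0 0 M.
  by rewrite -[LHS](mulKmx Pu) [P *m _]mulmxA PT mulmxK.
by rewrite !mulmxA PTi -[_ *m B]mulmxA NB -!mulmxA -!trmx_mul PTi.
Qed.

(** * Shuffle matrices *)

(** The matrix is invertible over the polynomials by the geometric series, so its
    determinant is a unit, that is, a constant; and its constant term is 1. *)
Lemma det_add1_X_nilpotent (K : fieldType) n (T : 'M[K]_n) k : T ^+ k = 0 ->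
  \det (1%:M + 'X *: map_mx polyC T) = 1.
Proof.
move=> Tk0; set M := 1%:M + _.
have powE i : ('X *: map_mx polyC T) ^+ i = 'X^i *: map_mx polyC (T ^+ i).
  elim: i => [|i IH]; first by rewrite !expr0 scale1r map_mx1.
  rewrite exprS IH -mulmxE -scalemxAl -scalemxAr scalerA -map_mxM mulmxE.
  by rewrite -!exprS.
have Nk0 : (- ('X *: map_mx polyC T)) ^+ k = 0.
  by rewrite exprNn powE Tk0 map_mx0 scaler0 mulr0.
have : \det M \is a GRing.unit.
  have := subrX1 (- ('X *: map_mx polyC T)) k.
  rewrite Nk0 sub0r -opprD => /eqP; rewrite mulNr eqr_opp => /eqP/esym e.
  have : \det M * \det (\sum_(i < k) (- ('X *: map_mx polyC T)) ^+ i) = 1.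
    by rewrite -det_mulmx /M addrC mulmxE e det1.
  by move=> u; apply/unitrPr; eexists; apply: u.
rewrite poly_unitE => /andP[/size_poly1P[c _ cE] _].
suff : coefp 0 (\det M) = 1 by rewrite cE /= coefC eqxx => ->.
rewrite -det_map_mx /M map_mxD map_mx1 map_mxZ /= coefX scale0r addr0.
exact: det1.
Qed.

Lemma shuffle_mx0 (K : fieldType) n l (T : 'M[K]_n) : shuffle_mx l T 0 = 1%:M.
Proof.
rewrite /shuffle_mx map_compound_mx map_mxD map_mx1 map_mxZ /= coefX scale0r.
by rewrite addr0 compound_mx1.
Qed.

(** Each entry of [1 + zT] has degree at most 1 and the minors are of order [l].
    So the [l] matrices that define the shuffle equations are all the
    coefficients of positive degree. *)
Lemma shuffle_mx_eq0 (K : fieldType) n l (T : 'M[K]_n) i : (l < i)%N ->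
  shuffle_mx l T i = 0.
Proof.
move=> li; apply/matrixP => I J; rewrite !mxE /= nth_default //.
apply: leq_trans li; apply: (leq_trans (size_sum _ _ _)).
apply/bigmax_leqP => p _; rewrite mulr_sign.
apply: (@leq_trans (size (\prod_(a < l) mxsub (tnth (subset_idx I))
   (tnth (subset_idx J)) (1%:M + 'X *: map_mx polyC T) a (p a)))).
  by case: ifP; rewrite ?size_polyN.
apply: (leq_trans (size_poly_prod_leq _ _)).
rewrite leq_subLR cardT size_enum_ord addnS ltnS.
apply: (@leq_trans (\sum_(a < l) 2)%N); last by rewrite sum_nat_const card_ord muln2 addnn.
apply: leq_sum => a _; rewrite !mxE.
apply: (leq_trans (size_polyD _ _)); rewrite geq_max; apply/andP; split.
  by case: (_ == _); rewrite ?size_poly1 ?size_poly0.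
rewrite mulrC; apply: (leq_trans (size_polyMleq _ _)).
by rewrite size_polyX addn2 /= ltnS size_polyC leq_b1.
Qed.

Lemma map_mx_coefpM (K : fieldType) a b c (X : 'M[{poly K}]_(a, b))
    (Y : 'M[{poly K}]_(b, c)) i :
  map_mx (coefp i) (X *m Y) =
  \sum_(j < i.+1) map_mx (coefp j) X *m map_mx (coefp (i - j)%N) Y.
Proof.
apply/matrixP => r s; rewrite !mxE summxE /= coef_sum.
under [LHS]eq_bigr do rewrite coefM.
rewrite exchange_big /=; apply: eq_bigr => j _; rewrite mxE.
by apply: eq_bigr => k _; rewrite !mxE.
Qed.

Lemma map_mx_coefpMC (K : fieldType) a b c (X : 'M[{poly K}]_(a, b))
    (F : 'M[K]_(b, c)) i :
  map_mx (coefp i) (X *m map_mx polyC F) = map_mx (coefp i) X *m F.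
Proof.
apply/matrixP => r s; rewrite !mxE /= coef_sum.
by apply: eq_bigr => k _; rewrite !mxE coefMC.
Qed.

(** The coefficient vectors of the shuffle equations span the sum of the column
    spaces of the shuffle matrices, encoded as a row space by transposition. *)
Definition shuffle_space (K : fieldType) n l (T : 'M[K]_n) : 'M[K]_'C(n, l) :=
  (\sum_(i < l) (shuffle_mx l T i.+1)^T)%MS.

Lemma shuffle_mx_sub (K : fieldType) n l (T : 'M[K]_n) i : (0 < i)%N ->
  ((shuffle_mx l T i)^T <= shuffle_space l T)%MS.
Proof.
case: i => // i _; have [il|il] := ltnP i l.
  by apply: (sumsmx_sup (Ordinal il)).
by rewrite shuffle_mx_eq0 // trmx0 sub0mx.
Qed.

Lemma shuffle_spanP (K : fieldType) n l (T : 'M[K]_n)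
    (g : 'Hom('rV[K]_'C(n, l), K^o)) :
  g \in shuffle_span l T <->
  exists2 w : 'rV[K]_'C(n, l), (w <= shuffle_space l T)%MS &
    forall P, g P = (P *m w^T) 0 0.
Proof.
split=> [|[w /sub_sumsmxP[u ->] gE]].
  move=> /(@coord_span _ _ _ (in_tuple _)) ->.
  apply: (big_ind (fun g : 'Hom('rV[K]_'C(n, l), K^o) =>
    exists2 w : 'rV[K]_'C(n, l), (w <= shuffle_space l T)%MS &
      forall P, g P = (P *m w^T) 0 0)).
  - by exists 0; rewrite ?sub0mx // => P; rewrite trmx0 mulmx0 zero_lfunE mxE.
  - move=> g1 g2 [w1 w1T g1E] [w2 w2T g2E]; exists (w1 + w2).
      exact: addmx_sub.
    by move=> P; rewrite add_lfunE g1E g2E linearD /= mulmxDr !mxE.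
  move=> k _; have /allpairsP[[i J] /= [+ _ ->]] := mem_nth 0 (ltn_ord k).
  rewrite mem_iota => /andP[i0 _]; set c := coord _ _ _.
  exists (c *: row J (shuffle_mx l T i)^T).
    by apply/scalemx_sub/(submx_trans (row_sub _ _))/shuffle_mx_sub.
  move=> P; rewrite scale_lfunE shuffle_formE linearZ /= -scalemxAr [RHS]mxE.
  by congr (_ * _); rewrite !mxE; apply: eq_bigr => a _; rewrite !mxE.
have -> : g = \sum_(i < l) \sum_J u i 0 J *: shuffle_form T i.+1 J.
  apply/lfunP => P; rewrite gE sum_lfunE linear_sum /= mulmx_sumr summxE.
  apply: eq_bigr => i _; rewrite sum_lfunE trmx_mul trmxK mulmxA mxE.
  by apply: eq_bigr => J _; rewrite scale_lfunE shuffle_formE mulrC [X in X * _]mxE.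
apply: memv_suml => i _; apply: memv_suml => J _; apply/memvZ/memv_span.
by apply: allpairs_f; rewrite ?mem_enum // mem_iota /= add1n ltnS.
Qed.

(** * Pulling back the shuffle equations *)

(** Says that [F] conjugates the compound matrix of order [m] into the inverse of
    the one of order [l]; in this form no inverse of [F] occurs. *)
Definition shuffle_intertwiner (K : fieldType) n l m (T : 'M[K]_n)
    (F : 'M[K]_('C(n, l), 'C(n, m))) :=
  let M := 1%:M + 'X *: map_mx polyC T in
  compound_mx l M *m map_mx polyC F *m compound_mx m M = map_mx polyC F.

(** The coefficient of degree [i.+1] of the intertwining identity expresses
    [F *m shuffle_mx m T i.+1] as a combination of the matrices
    [shuffle_mx l T j.+1] multiplied on the right, because the constant
    coefficient of a compound matrix is the identity. *)
Lemma shuffle_intertwiner_sub (K : fieldType) n l m (T : 'M[K]_n)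
    (F : 'M[K]_('C(n, l), 'C(n, m))) :
  shuffle_intertwiner T F ->
  (shuffle_space m T *m F^T <= shuffle_space l T)%MS.
Proof.
move=> FT; rewrite sumsmxMr_gen; apply/sumsmx_subP => i _; rewrite genmxE.
have := congr1 (map_mx (coefp i.+1)) FT.
have -> : map_mx (coefp i.+1) (map_mx polyC F) = 0.
  by apply/matrixP => r s; rewrite !mxE /= coefC.
rewrite map_mx_coefpM big_ord_recl /= subn0 map_mx_coefpMC.
rewrite -![map_mx _ (compound_mx _ _)]/(shuffle_mx _ _ _) shuffle_mx0 mul1mx.
move/eqP; rewrite addr_eq0 => /eqP FE.
rewrite -trmx_mul FE linearN /= eqmx_opp linear_sum /=.
apply: summx_sub => j _; rewrite map_mx_coefpMC -mulmxA trmx_mul.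
by apply: mulmx_sub; apply: shuffle_mx_sub.
Qed.

Lemma shuffle_span_pullback (K : fieldType) n l m (T : 'M[K]_n)
    (F : 'M[K]_('C(n, l), 'C(n, m))) (f : 'Hom('rV[K]_'C(n, m), K^o)) :
  shuffle_intertwiner T F -> f \in shuffle_span m T ->
  (f \o linfun (mulmxr F))%VF \in shuffle_span l T.
Proof.
move=> FT /shuffle_spanP[w wT fE]; apply/shuffle_spanP; exists (w *m F^T).
  by apply: submx_trans (shuffle_intertwiner_sub FT); apply: submxMr.
by move=> P; rewrite comp_lfunE fE lfunE /= trmx_mul trmxK mulmxA.
Qed.

(** The identity says that the compound matrix of order [l] is inverse to a
    conjugate of the one of order [m], and inverses are two-sided. *)
Lemma shuffle_intertwiner_inv (K : fieldType) n l m (T : 'M[K]_n)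
    (F : 'M[K]_('C(n, l), 'C(n, m))) (G : 'M[K]_('C(n, m), 'C(n, l))) :
  F *m G = 1%:M -> G *m F = 1%:M ->
  shuffle_intertwiner T F -> shuffle_intertwiner T G.
Proof.
rewrite /shuffle_intertwiner; set M := 1%:M + _ => FG GF FT.
have pFG : map_mx polyC F *m map_mx polyC G = 1%:M by rewrite -map_mxM FG map_mx1.
have pGF : map_mx polyC G *m map_mx polyC F = 1%:M by rewrite -map_mxM GF map_mx1.
have /mulmx1C e : compound_mx l M *m (map_mx polyC F *m compound_mx m M *m map_mx polyC G) = 1%:M.
  by rewrite !mulmxA FT pFG.
by rewrite -[LHS]mul1mx -pGF -!mulmxA; rewrite -!mulmxA in e; rewrite e mulmx1.
Qed.

(** From [S *m M = M^T *m S] for [M = 1 + zT], the compound matrix of [S] turns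
    the compound matrix of [M] into its transpose, and [compound_wedge_mx]
    applies with determinant 1. *)
Lemma compound_wedge_intertwiner (K : fieldType) l m (T S : 'M[K]_(l + m)) k :
  T ^+ k = 0 -> S *m T = T^T *m S ->
  shuffle_intertwiner T (wedge_mx K l m *m compound_mx m S).
Proof.
move=> Tk ST; rewrite /shuffle_intertwiner; set M := 1%:M + _.
have SM : map_mx polyC S *m M = M^T *m map_mx polyC S.
  rewrite mulmxDr linearD /= mulmxDl trmx1 mulmx1 mul1mx; congr (_ + _).
  by rewrite -scalemxAr linearZ /= -scalemxAl map_trmx -!map_mxM ST.
rewrite map_mxM map_compound_mx -!mulmxA -compound_mxM SM compound_mxM.
rewrite compound_mx_tr !mulmxA.
have -> : map_mx polyC (wedge_mx K l m) = wedge_mx {poly K} l m.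
  apply/matrixP => I J; rewrite !mxE -det_map_mx map_col_mx !map_mxsub.
  by rewrite !map_mx1.
by rewrite compound_wedge_mx (det_add1_X_nilpotent Tk) scale1r.
Qed.

(** * Stable subspaces under the duality *)

Lemma plucker_line (K : fieldType) n l m (A : 'M[K]_(l, n)) (B : 'M[K]_(m, n))
    (F : 'M[K]_('C(n, l), 'C(n, m))) c : c != 0 ->
  plucker A *m F = c *: plucker B ->
  (linfun (mulmxr F) @: <[plucker A]>)%VS = <[plucker B]>%VS.
Proof.
move=> c0 e; rewrite limg_line lfunE /= e; apply/eqP; rewrite eqEsubv.
rewrite -!memvE memvZ ?memv_line //=.
by rewrite -{1}[plucker B](scalerK c0) memvZ ?memv_line.
Qed.

Lemma wedge_compound_plucker (K : fieldType) l m (S : 'M[K]_(l + m))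
    (A : 'M[K]_(l, l + m)) (B : 'M[K]_(m, l + m)) :
    row_free A -> row_free B -> A *m B^T = 0 ->
  (linfun (mulmxr (wedge_mx K l m *m compound_mx m S)) @: <[plucker A]>)%VS
    = <[plucker (B *m S)]>%VS.
Proof.
move=> fA fB AB0; have [c c0 e] := wedge_mx_orthogonal fA fB AB0.
apply: (plucker_line c0); rewrite mulmxA -[plucker A]/(minors A) e -scalemxAl.
by rewrite -minorsM.
Qed.

Lemma orthogonal_stable (K : fieldType) n l m (A : 'M[K]_(l, n))
    (B : 'M[K]_(m, n)) (T : 'M[K]_n) :
    A *m B^T = 0 -> (A *m T <= A)%MS ->
    (forall p (X : 'M[K]_(p, n)), A *m X^T = 0 -> (X <= B)%MS) ->
  (B *m T^T <= B)%MS.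
Proof.
move=> AB0 /submxP[X XA]; apply.
by rewrite trmx_mul trmxK mulmxA XA -mulmxA AB0 mulmx0.
Qed.

(** [A |-> A^perp *m S] sends [T]-stable spaces to [T]-stable ones.  It is onto
    because [B *m invmx S] is stable under [T^T], so its annihilator, whose
    annihilator it is in turn, is stable under [T]. *)
Lemma grassmannian_fixed_wedge (K : fieldType) l m (T S : 'M[K]_(l + m)) :
    S \in unitmx -> S *m T = T^T *m S ->
  let phi := linfun (mulmxr (wedge_mx K l m *m compound_mx m S)) in
  forall y : {vspace 'rV[K]_'C(l + m, m)},
  grassmannian_fixed T y <->
  exists2 x : {vspace 'rV[K]_'C(l + m, l)},
    grassmannian_fixed T x & y = (phi @: x)%VS.
Proof.
move=> Su ST phi y; split=> [[B [fB BT yE]]|[x [A [fA AT ->]] ->]]; last first.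
  have [B [fB AB0 Bmax]] := orthogonal_complement (erefl _) fA.
  have BT := orthogonal_stable AB0 AT Bmax.
  exists (B *m S); split; last exact: wedge_compound_plucker.
    by rewrite /row_free mxrankMfree ?row_free_unit.
  by rewrite -mulmxA ST mulmxA submxMr.
pose B0 := B *m invmx S.
have BE : B0 *m S = B by rewrite mulmxKV.
have fB0 : row_free B0 by rewrite /row_free mxrankMfree ?row_free_unit ?unitmx_inv.
have B0T : (B0 *m T^T <= B0)%MS.
  have -> : B0 *m T^T = B *m T *m invmx S.
    by rewrite -[LHS](mulmxK Su) -[_ *m S]mulmxA -ST mulmxA BE.
  exact: submxMr.
have [A [fA B0A Amax]] := orthogonal_complement (addnC m l) fB0.
have AT := orthogonal_stable B0A B0T Amax.
have AB0 : A *m B0^T = 0 by rewrite -[A]trmxK -trmx_mul B0A trmx0.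
exists <[plucker A]>%VS; first by exists A; split; rewrite // -[T]trmxK.
by rewrite yE -BE -(wedge_compound_plucker S fA fB0 AB0).
Qed.

(** * The duality *)

(** The complementary dimension is a variable [m] here, so that [n] can be
    replaced by [l + m], the shape required by block matrices. *)
Lemma shuffle_duality (K : fieldType) n l m (T : 'M[K]_n) k :
    (l + m = n)%N -> T ^+ k = 0 ->
  exists phi : 'Hom('rV[K]_'C(n, l), 'rV[K]_'C(n, m)),
    [/\ bijective phi,
        (forall y : {vspace 'rV[K]_'C(n, m)},
           grassmannian_fixed T y <->
           exists2 x : {vspace 'rV[K]_'C(n, l)},
             grassmannian_fixed T x & y = (phi @: x)%VS)
      & (forall g : 'Hom('rV[K]_'C(n, l), K^o),
           g \in shuffle_span l T <->
           exists2 f : 'Hom('rV[K]_'C(n, m), K^o),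
             f \in shuffle_span m T & g = (f \o phi)%VF)].
Proof.
move=> lm Tk; subst n.
have [R Ru TR] := nilpotent_tr_similar Tk.
pose S := invmx R; have Su : S \in unitmx by rewrite unitmx_inv.
have ST : S *m T = T^T *m S.
  by rewrite -[LHS](mulmxK Ru) -[S *m T *m R]mulmxA TR mulKmx.
have [W EW WE] := wedge_mx_invertible K l m.
have cSK : compound_mx m S *m compound_mx m R = 1%:M.
  by rewrite -compound_mxM mulVmx ?compound_mx1.
pose F := wedge_mx K l m *m compound_mx m S.
pose G := compound_mx m R *m W.
have FG : F *m G = 1%:M by rewrite /F /G mulmxA -[_ *m compound_mx m R]mulmxA cSK mulmx1.
have GF : G *m F = 1%:M.
  by rewrite /F /G mulmxA -[_ *m W *m _]mulmxA WE mulmx1 (mulmx1C cSK).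
have FT : shuffle_intertwiner T F := compound_wedge_intertwiner Tk ST.
have GT := shuffle_intertwiner_inv FG GF FT.
exists (linfun (mulmxr F)); split.
- exists (linfun (mulmxr G)) => P; rewrite !lfunE /= -mulmxA.
    by rewrite FG mulmx1.
  by rewrite GF mulmx1.
- exact: grassmannian_fixed_wedge.
move=> g; split=> [gT|[f fT ->]]; last exact: shuffle_span_pullback.
exists (g \o linfun (mulmxr G))%VF; first exact: shuffle_span_pullback.
by apply/lfunP => P; rewrite !comp_lfunE !lfunE /= -mulmxA FG mulmx1.
Qed.

Theorem theorem5 (K : fieldType) (n l : nat) (T : 'M[K]_n)
    (hln : (l <= n)%N) (hn : (1 <= n)%N)
    (hT : exists k : nat, T ^+ k = 0) :
  exists phi : 'Hom('rV[K]_'C(n, l), 'rV[K]_'C(n, n - l)),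
    [/\ bijective phi,
        (forall y : {vspace 'rV[K]_'C(n, n - l)},
           grassmannian_fixed T y <->
           exists2 x : {vspace 'rV[K]_'C(n, l)},
             grassmannian_fixed T x & y = (phi @: x)%VS)
      & (forall g : 'Hom('rV[K]_'C(n, l), K^o),
           g \in shuffle_span l T <->
           exists2 f : 'Hom('rV[K]_'C(n, n - l), K^o),
             f \in shuffle_span (n - l) T & g = (f \o phi)%VF)].
Proof.
by have [k Tk] := hT; apply: (shuffle_duality (subnKC hln) Tk).
Qed.
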